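(* Let $q\ge1$ and let $p_0,p_1,\dots,p_q$ be nonnegative reals with $\sum_{i=0}^q p_i=1$. If $\mathcal{F}=\{(\mathbf{x}^j,\mathbf{y}^j):1\le j\le m\}$ is a saturated weak $(q+1)$-sum IVP-system in $\{0,\dots,q\}^{<\mathbb{N}}$, then \[ \sum_{j=1}^m\prod_{i=0}^q p_i^{\alpha^j_i}\le 1, \] where $\alpha^j_i=|\{t\in S_{\mathbf{x}^j}\cup S_{\mathbf{y}^j}: x^j_t=i\}|$ (with the convention $0^0=1$).
   Context: $\{0,\dots,q\}^{<\mathbb{N}}$ is the set of infinite sequences with entries in $\{0,\dots,q\}$ and finite support $S_{\mathbf{x}}=\{i:x_i\ne0\}$. For $\mathbf{x},\mathbf{y}$ put $|\mathbf{x}\cap_{q+1}\mathbf{y}|=|\{i:x_i+y_i\ge q+1\}|$. A weak $(q+1)$-sum IVP-system is a system of pairs $(\mathbf{x}^j,\mathbf{y}^j)$, $j=1,\dots,m$, with $|\mathbf{x}^j\cap_{q+1}\mathbf{y}^j|=0$ for all $j$ such that for all $i\ne j$ at least one of $|\mathbf{x}^i\cap_{q+1}\mathbf{y}^j|$, $|\mathbf{x}^j\cap_{q+1}\mathbf{y}^i|$ is nonzero. It is saturated if for every $j$ and every coordinate $i$ with $x^j_i+y^j_i>0$ we have $x^j_i+y^j_i=q$. *)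

(* Defs.v *)
From mathcomp Require Import all_boot all_order all_algebra.
From mathcomp Require Import finmap reals.

Set Implicit Arguments.
Unset Strict Implicit.
Unset Printing Implicit Defensive.

Local Open Scope fset_scope.

(* The index set of the coordinates is nat; [finsupp x] is the support S_x. *)
Definition fvec (q : nat) : Type := {fsfun nat -> 'I_q.+1 with ord0}.

(* The set {i : x_i + y_i >= q+1}. It is finite because it lies inside the
   union of the supports; [in_sumcap] shows that bounding i loses nothing. *)
Definition sumcap (q : nat) (x y : fvec q) : {fset nat} :=
  [fset i in finsupp x `|` finsupp y | (q.+1 <= x i + y i)%N].

Lemma in_sumcap (q : nat) (x y : fvec q) (i : nat) :
  (i \in sumcap x y) = (q.+1 <= x i + y i)%N.
Proof.
rewrite !inE /= andb_idl // => h; apply/orP.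
have [xi|xi] := boolP (i \in finsupp x); first by left.
have [yi|yi] := boolP (i \in finsupp y); first by right.
by move: h; rewrite (fsfun_dflt xi) (fsfun_dflt yi).
Qed.

Definition weak_IVP_system (q m : nat) (F : 'I_m -> fvec q * fvec q) : Prop :=
  (forall j : 'I_m, #|` sumcap (F j).1 (F j).2| = 0%N) /\
  (forall i j : 'I_m, i <> j ->
     #|` sumcap (F i).1 (F j).2| <> 0%N \/ #|` sumcap (F j).1 (F i).2| <> 0%N).

Definition saturated (q m : nat) (F : 'I_m -> fvec q * fvec q) : Prop :=
  forall (j : 'I_m) (t : nat),
    (0 < (F j).1 t + (F j).2 t)%N -> ((F j).1 t + (F j).2 t)%N = q.

Definition alpha (q : nat) (x y : fvec q) (i : 'I_q.+1) : nat :=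
  #|` [fset t in finsupp x `|` finsupp y | x t == i]|.

(* Main.v *)
Require Import Defs.
From mathcomp Require Import all_boot all_order all_algebra.
From mathcomp Require Import finmap reals.

(** Draw a random word [z] whose coordinates are independent with law [p]. The
    [j]-th summand is the probability that [z] agrees with [x^j] on the support
    of the [j]-th pair. These events are pairwise disjoint: if
    [x^i_t + y^j_t > q], then [t] lies in both supports, and by saturation
    [x^j_t = q - y^j_t < x^i_t]. *)

Set Implicit Arguments.
Unset Strict Implicit.
Unset Printing Implicit Defensive.

Import Order.TTheory GRing.Theory Num.Theory.
Local Open Scope fset_scope.
Local Open Scope ring_scope.

Definition pair_supp (q : nat) (P : fvec q * fvec q) : {fset nat} :=
  finsupp P.1 `|` finsupp P.2.

Lemma mem_pair_supp (q : nat) (P : fvec q * fvec q) (t : nat) :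
  (t \in pair_supp P) = (0 < P.1 t + P.2 t)%N.
Proof. by rewrite in_fsetU !mem_finsupp addn_gt0 !lt0n. Qed.

Lemma saturated_differ (q m : nat) (F : 'I_m -> fvec q * fvec q) (i j : 'I_m)
    (t : nat) :
  saturated F -> t \in sumcap (F i).1 (F j).2 ->
  [/\ t \in pair_supp (F i), t \in pair_supp (F j) & (F i).1 t != (F j).1 t].
Proof.
move=> satF; rewrite in_sumcap => gt_q.
(* Entries are at most [q], so a sum above [q] forces both terms to be positive. *)
have xi_gt0 : (0 < (F i).1 t)%N.
  rewrite lt0n; apply: contraTneq gt_q => ->.
  by rewrite -leqNgt -ltnS ltn_ord.
have yj_gt0 : (0 < (F j).2 t)%N.
  rewrite lt0n; apply: contraTneq gt_q => ->.
  by rewrite addn0 -leqNgt -ltnS ltn_ord.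
rewrite !mem_pair_supp !addn_gt0 xi_gt0 yj_gt0 orbT; split=> //.
apply: contraTneq gt_q => ->.
by rewrite satF ?ltnn // addn_gt0 yj_gt0 orbT.
Qed.

Lemma weak_IVP_differ (q m : nat) (F : 'I_m -> fvec q * fvec q) (i j : 'I_m) :
  weak_IVP_system F -> saturated F -> i <> j ->
  exists t : nat,
    [/\ t \in pair_supp (F i), t \in pair_supp (F j) & (F i).1 t != (F j).1 t].
Proof.
move=> [_ weakF] satF /weakF[] /eqP; rewrite -lt0n cardfs_gt0 => /fset0Pn[t].
  by move=> /(saturated_differ satF); exists t.
by move=> /(saturated_differ satF)[ti tj neq]; exists t; rewrite eq_sym.
Qed.

(** Group the coordinates of the support by the value of [P.1] there; [alpha] counts each class. *)
Lemma prod_exp_alpha (R : comPzSemiRingType) (q : nat) (p : 'I_q.+1 -> R)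
    (P : fvec q * fvec q) :
  \prod_(i < q.+1) p i ^+ alpha P.1 P.2 i = \prod_(t <- pair_supp P) p (P.1 t).
Proof.
rewrite (partition_big (fun t => P.1 t) xpredT) //=; apply: eq_bigr => i _.
rewrite (eq_bigr (fun=> p i)) => [|t /eqP-> //].
by rewrite big_fset_condE big_const_seq count_predT -Monoid.iteropE.
Qed.

Definition word_weight (R : pzSemiRingType) (T A : finType) (p : A -> R)
    (z : {ffun T -> A}) : R :=
  \prod_t p (z t).

Lemma sum_word_weight (R : comPzSemiRingType) (T A : finType) (p : A -> R) :
  \sum_i p i = 1 -> \sum_(z : {ffun T -> A}) word_weight p z = 1.
Proof.
by move=> p_sum1; rewrite -(bigA_distr_bigA (fun _ : T => p)) big1.
Qed.

(** A cylinder event. Points of [S] outside [D] impose nothing, which is why [cylinder_weight] asks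
    that [D] contain [S]. *)
Definition agrees_on (A : finType) (D S : {fset nat}) (x : nat -> A)
    (z : {ffun D -> A}) : bool :=
  [forall t : D, (val t \in S) ==> (z t == x (val t))].

(** By independence the sum factors over [D]: a coordinate in [S] leaves the single term [p (x t)],
    any other one the total mass 1. *)
Lemma cylinder_weight (R : comPzSemiRingType) (A : finType) (p : A -> R)
    (D S : {fset nat}) (x : nat -> A) :
  \sum_i p i = 1 -> S `<=` D ->
  \sum_(z : {ffun D -> A} | agrees_on S x z) word_weight p z
    = \prod_(t <- S) p (x t).
Proof.
move=> p_sum1 sSD.
pose Q (t : nat) : pred A := fun i => (t \in S) ==> (i == x t).
rewrite (eq_bigl (fun z => z \in family (fun t : D => Q (val t)))); last first.
  by move=> z; apply/forallP/familyP.
rewrite -(bigA_distr_big_dep (fun t : D => Q (val t)) (fun _ : D => p)) /=.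
rewrite -(big_seq_fsetE _ D xpredT (fun t => \sum_(i | Q t i) p i)) /=.
rewrite -(big_fset_incl _ sSD) => [|t _ /negbTE tS]; last first.
  by rewrite -[RHS]p_sum1; apply: eq_bigl => i; rewrite /Q tS.
rewrite big_seq [RHS]big_seq; apply: eq_bigr => t tS.
by rewrite (big_pred1 (x t)) // => i; rewrite /Q tS.
Qed.

Theorem theorem3p4 (R : realType) (q m : nat) (p : 'I_q.+1 -> R)
    (F : 'I_m -> fvec q * fvec q) :
  (1 <= q)%N ->
  (forall i : 'I_q.+1, 0 <= p i) ->
  \sum_(i < q.+1) p i = 1 ->
  weak_IVP_system F ->
  saturated F ->
  \sum_(j < m) \prod_(i < q.+1) p i ^+ alpha (F j).1 (F j).2 i <= 1.
Proof.
move=> _ p_ge0 p_sum1 weakF satF.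
(* Only finitely many coordinates matter, so words on [D] suffice and the probability space is
   finite. *)
pose D := \bigcup_(j <- enum 'I_m) pair_supp (F j).
have sD j : pair_supp (F j) `<=` D by apply: bigfcup_sup; rewrite ?mem_enum.
under eq_bigr => j _ do rewrite prod_exp_alpha -(cylinder_weight _ p_sum1 (sD j)).
(* After the exchange, [z] contributes its weight once for each [j] whose cylinder contains it; it
   remains to see that there is at most one such [j]. *)
rewrite (exchange_big_dep xpredT) //= -[leRHS](sum_word_weight D p_sum1).
apply: ler_sum => z _; have w_ge0 : 0 <= word_weight p z by apply: prodr_ge0.
have [j zj|z0] := pickP (fun j => agrees_on (pair_supp (F j)) (F j).1 z); last first.
  by rewrite big_pred0.
rewrite (big_pred1 j) // => i; apply/idP/eqP => [zi|-> //].
have [//|/eqP neq_ij] := eqVneq i j.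
(* At a common support point [t] where the two first vectors differ, [z t] would have to equal both
   values. *)
have [t [ti tj /eqP[]]] := weak_IVP_differ weakF satF neq_ij.
have tD : t \in D by apply: (fsubsetP (sD i)).
have /implyP/(_ ti)/eqP /= <- := forallP zi [` tD].
by have /implyP/(_ tj)/eqP := forallP zj [` tD].
Qed.
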